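(* Let $A\in\mathbb{C}^{m\times n}$ have rank $a$, let $c\in\mathbb{C}^{m\times 1}$, and let $Q\in\mathbb{C}^{m\times m}$ and $P\in\mathbb{C}^{n\times n}$ be regular matrices such that $QAP=E_a$. Then the linear system $Ax=c$ has a solution $x\in\mathbb{C}^{n\times 1}$ if and only if the last $m-a$ coordinates of the vector $c'=Qc$ are zeros.
   Context: A regular matrix is an invertible square matrix. $E_a=\left[\begin{array}{c|c} I_a & 0\\ \hline 0&0\end{array}\right]\in\mathbb{C}^{m\times n}$, where $I_a$ is the $a\times a$ identity matrix. Blocks may be empty (when $a=m$ the condition on the last $m-a$ coordinates is vacuous). *)

(* Defs.v *)
From mathcomp Require Import all_boot all_order all_algebra.
From mathcomp Require Import reals complex.

Set Implicit Arguments.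
Unset Strict Implicit.
Unset Printing Implicit Defensive.

(* Main.v *)
Require Import Defs.
From mathcomp Require Import all_boot all_order all_algebra.
From mathcomp Require Import reals complex.
Import GRing.Theory.
Local Open Scope ring_scope.

(** Multiplying by the regular matrix [Q] and substituting [x = P y] turns
    [A x = c] into the equivalent system [E_a y = Q c].  Let [D] be
    the [m x m] partial identity of rank [a], the projection that keeps the
    first [a] coordinates and kills the others; its fixed vectors are those
    whose last coordinates vanish ([pid_mx_fixP]).  Since [D E_a = E_a], every
    vector [E_a y] is fixed by [D].  Conversely, [a <= n] gives
    [D = E_a E_a^T], so a vector [v] fixed by [D] is [E_a y] for
    [y = E_a^T v] ([pid_mx_solvable]). *)

Lemma pid_mx_fixP (K : pzSemiRingType) (m a : nat) (v : 'cV[K]_m) :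
  (pid_mx a : 'M_m) *m v = v <-> (forall i : 'I_m, (a <= i)%N -> v i 0 = 0).
Proof.
have pidE i : ((pid_mx a : 'M_m) *m v) i 0 = if (i < a)%N then v i 0 else 0.
  rewrite mxE (bigD1 i) //= big1 => [|j neq_ji]; last first.
    by rewrite mxE -val_eqE in neq_ji *; rewrite eq_sym (negbTE neq_ji) mul0r.
  by rewrite mxE eqxx addr0; case: ifP => _; rewrite ?mul1r ?mul0r.
split=> [fix_v i le_ai | v0]; first by rewrite -fix_v pidE ltnNge le_ai.
apply/colP=> i; rewrite pidE; case: ltnP => // le_ai.
by rewrite v0.
Qed.

(** The bound [a <= n] ensures that passing through [n] coordinates loses none
    of the first [a]; without it the left-hand system would also force the
    coordinates of [v] from [n] up to vanish. *)
Lemma pid_mx_solvable (K : pzSemiRingType) (m n a : nat) (v : 'cV[K]_m) :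
  (a <= n)%N ->
  (exists y : 'cV[K]_n, pid_mx a *m y = v) <->
  (forall i : 'I_m, (a <= i)%N -> v i 0 = 0).
Proof.
move=> le_an; rewrite -pid_mx_fixP; split=> [[y <-] | fix_v].
  by rewrite mulmxA mul_pid_mx minnn pid_mx_minv.
by exists (pid_mx a *m v); rewrite mulmxA pid_mx_id.
Qed.

(** The two systems have solutions related by the bijection [x = P y]. *)
Lemma equiv_mx_solvable (K : comUnitRingType) (m n : nat)
    (A E : 'M[K]_(m, n)) (Q : 'M[K]_m) (P : 'M[K]_n) (c : 'cV[K]_m) :
  Q \in unitmx -> P \in unitmx -> Q *m A *m P = E ->
  (exists x : 'cV[K]_n, A *m x = c) <->
  (exists y : 'cV[K]_n, E *m y = Q *m c).
Proof.
move=> regQ regP <-; split=> [[x <-] | [y Ey]].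
  by exists (invmx P *m x); rewrite -!mulmxA mulKVmx.
exists (P *m y); apply: (can_inj (mulKmx regQ)).
by rewrite -Ey !mulmxA.
Qed.

Theorem lemma2p1 (R : realType) (m n a : nat)
    (A : 'M[complex R]_(m, n)) (c : 'cV[complex R]_m)
    (Q : 'M[complex R]_m) (P : 'M[complex R]_n)
    (rankA : \rank A = a)
    (regQ : Q \in unitmx) (regP : P \in unitmx)
    (QAP : Q *m A *m P = pid_mx a) :
  (exists x : 'cV[complex R]_n, A *m x = c) <->
  (forall i : 'I_m, (a <= i)%N -> (Q *m c) i 0 = 0).
Proof.
have le_an : (a <= n)%N by rewrite -rankA rank_leq_col.
apply: iff_trans (equiv_mx_solvable _ _ _ _ _ _ _ c regQ regP QAP) _.
exact: pid_mx_solvable.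
Qed.
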